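(* Let $\Sigma=(G,\sigma)$ be a signed graph with $m$ edges and let $k$ be a positive integer with $$k>\frac{m-1}{\ln(1+\sqrt{2})}.$$ Then $P_l^0(\Sigma,k)=P(\Sigma,k)$ if $k$ is even, and $P_l^1(\Sigma,k)=P(\Sigma,k)$ if $k$ is odd. Further, a list-assignment $L$ attaining this equality (i.e., a $0$-free $k$-assignment when $k$ is even, resp. a $0$-included $k$-assignment when $k$ is odd, with $P(\Sigma,L)=P(\Sigma,k)$) satisfies $L(v)=\sigma(e)L(u)$ for each edge $e=uv$. In particular, if $\Sigma$ is unbalanced, then such an $L$ satisfies $L(v)=-L(v)$ for each vertex $v$ in any unbalanced component of $\Sigma$.
   Context: A signed graph $\Sigma=(G,\sigma)$ is a finite graph $G$ with a sign function $\sigma:E(G)\to\{-1,1\}$; an edge $e$ is negative if $\sigma(e)=-1$ and positive otherwise. A cycle is unbalanced if it has an odd number of negative edges and balanced otherwise; a signed graph (or a component) is unbalanced if it contains an unbalanced cycle and balanced otherwise. For a positive integer $k$, let $M_k=\{0,\pm1,\ldots,\pm t\}$ if $k=2t+1$ and $M_k=\{\pm1,\ldots,\pm t\}$ if $k=2t$. A proper $k$-coloring of $\Sigma$ is a map $c:V(\Sigma)\to M_k$ with $c(u)\neq\sigma(e)c(v)$ for every edge $e=uv$; $P(\Sigma,k)$ denotes the number of proper $k$-colorings. A list-assignment $L$ assigns to each vertex $v$ a nonempty set $L(v)\subseteq\mathbb{Z}$; it is a $k$-assignment if $|L(v)|=k$ for all $v$. An $L$-coloring is a map $c$ with $c(v)\in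 L(v)$ for all $v$ and $c(u)\neq\sigma(e)c(v)$ for every edge $e=uv$; $P(\Sigma,L)$ is the number of $L$-colorings. For $S\subseteq\mathbb{Z}$ and $s\in\{\pm1\}$, $sS=\{sa:a\in S\}$. $L$ is $0$-free if $0\notin L(v)$ for all $v$, and $0$-included if $0\in L(v)$ for all $v$. Define $P_l^0(\Sigma,k)=\min\{P(\Sigma,L): L \text{ a } 0\text{-free } k\text{-assignment}\}$ and $P_l^1(\Sigma,k)=\min\{P(\Sigma,L): L\text{ a }0\text{-included }k\text{-assignment}\}$. *)

(* Defs.v *)
From HB Require Import structures.
From mathcomp Require Import all_boot all_order all_algebra.
From mathcomp Require Import finmap.
From mathcomp Require Import boolp classical_sets reals exp.

Set Implicit Arguments.
Unset Strict Implicit.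
Unset Printing Implicit Defensive.

Import Order.TTheory GRing.Theory Num.Theory.
Local Open Scope ring_scope.
Local Open Scope fset_scope.

(* Finite multigraphs without loops: parallel edges (possibly of opposite
   signs) are allowed. Simple graphs are the case where [ends] is injective.
   Loops are excluded, since they falsify the statement about the lists: for
   a single vertex v with one negative loop and k even, every 0-free
   k-assignment has exactly k colorings, whether or not L(v) = - L(v). *)
Record signed_graph := SignedGraph {
  vertex : finType;
  edge : finType;
  ends : edge -> {set vertex};
  sigma : edge -> int;
  card_ends : forall e, #|ends e| = 2;
  sigma_sign : forall e, sigma e = 1 \/ sigma e = -1
}.

Section SignedGraph.
Variable S : signed_graph.
Local Notation V := (vertex S).
Local Notation E := (edge S).

Definition joins (e : E) (u v : V) : bool := ends e == [set u; v]%SET.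

Definition adj : rel V := fun u v => [exists e : E, joins e u v].

(* The cycle v_0 e_0 v_1 e_1 ... v_(l-1) e_(l-1) v_0, where vs lists the v_i
   and es the e_i; two parallel edges form a cycle with l = 2. *)
Definition is_cycle (vs : seq V) (es : seq E) : bool :=
  [&& (0 < size vs)%N, uniq vs, uniq es
    & [seq ends e | e <- es] ==
      [seq [set p.1; p.2]%SET | p <- zip vs (rot 1 vs)]].

Definition unbalanced_cycle (vs : seq V) (es : seq E) : bool :=
  is_cycle vs es && odd (count (fun e => sigma e == -1) es).

Definition unbalanced : Prop := exists vs es, unbalanced_cycle vs es.

Definition is_component (C : {set V}) : Prop :=
  exists v : V, C = [set w | connect adj v w]%SET.

Definition unbalanced_component (C : {set V}) : Prop :=
  is_component C /\
  exists vs es, unbalanced_cycle vs es /\ {subset vs <= C}.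

Definition proper_coloring (c : V -> int) : bool :=
  [forall e : E, forall u : V, forall v : V,
     joins e u v ==> (c u != sigma e * c v)].

Definition Mk (k : nat) : {fset int} :=
  (if odd k then [fset 0] else fset0) `|`
  [fset i%:Z | i in iota 1 k./2] `|` [fset - i%:Z | i in iota 1 k./2].

Definition P_Sigma (k : nat) : nat :=
  #|[set c : {ffun V -> Mk k} | proper_coloring (fun v => val (c v))]%SET|.

Definition P_list (L : V -> {fset int}) : nat :=
  #|[set c : {dffun forall v : V, L v} | proper_coloring (fun v => val (c v))]%SET|.

Definition k_assignment (k : nat) (L : V -> {fset int}) : Prop :=
  forall v, #|` L v| = k.

Definition zero_free (L : V -> {fset int}) : Prop := forall v, 0 \notin L v.

Definition zero_included (L : V -> {fset int}) : Prop := forall v, 0 \in L v.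

(* Has the default value 0 if A is empty; see [min_natP]. *)
Definition min_nat (A : set nat) : nat :=
  xget 0%N (fun n => A n /\ forall p, A p -> (n <= p)%N).

Definition P_l0 (k : nat) : nat :=
  min_nat (fun n => exists L : V -> {fset int},
    [/\ k_assignment k L, zero_free L & P_list L = n]).

Definition P_l1 (k : nat) : nat :=
  min_nat (fun n => exists L : V -> {fset int},
    [/\ k_assignment k L, zero_included L & P_list L = n]).

End SignedGraph.

Definition scale (s : int) (A : {fset int}) : {fset int} :=
  [fset s * a | a in A].

Lemma min_natP (A : set nat) : (exists n, A n) ->
  A (min_nat A) /\ forall p, A p -> (min_nat A <= p)%N.
Proof.
case=> n An; rewrite /min_nat.
case: xgetP => [p _ //|nP]; exfalso.
have exA : exists n, `[< A n >] by exists n; apply/asboolP.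
case: (ex_minnP exA) => p /asboolP Ap minp; apply: (nP p).
by split=> // q Aq; apply: minp; apply/asboolP.
Qed.

Lemma zero_free_assignment_ex (S : signed_graph) (k : nat) :
  exists L : vertex S -> {fset int}, k_assignment k L /\ zero_free L.
Proof.
exists (fun _ => [fset i%:Z | i in iota 1 k]); split=> v.
  rewrite card_imfset /=; last by move=> i j [].
  by rewrite undup_id ?iota_uniq // size_iota.
by apply/imfsetP => -[i /=]; rewrite mem_iota => /andP[i0 _] [] i00; rewrite -i00 in i0.
Qed.

Lemma zero_included_assignment_ex (S : signed_graph) (k : nat) : (0 < k)%N ->
  exists L : vertex S -> {fset int}, k_assignment k L /\ zero_included L.
Proof.
move=> k0; exists (fun _ => [fset i%:Z | i in iota 0 k]); split=> v.
  rewrite card_imfset /=; last by move=> i j [].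
  by rewrite undup_id ?iota_uniq // size_iota.
by apply/imfsetP; exists 0%N => //=; rewrite mem_iota.
Qed.

Lemma in_Mk (k : nat) (x : int) :
  (x \in Mk k) = (`|x|%N <= k./2)%N && (odd k || (x != 0)).
Proof.
apply/idP/idP.
  rewrite !in_fsetU => /orP[/orP[]|].
  - by case: (odd k); rewrite ?inE // => /eqP->.
  - case/imfsetP => i /=; rewrite mem_iota add1n ltnS => /andP[i0 ik] ->.
    by rewrite /= ik; case: i i0 {ik} => //= i _; rewrite orbT.
  - case/imfsetP => i /=; rewrite mem_iota add1n ltnS => /andP[i0 ik] ->.
    by rewrite abszN /= ik; case: i i0 {ik} => //= i _; rewrite orbT.
case/andP=> xk; rewrite !in_fsetU; case: (eqVneq x 0) => [->|x0 _].
  by rewrite orbF => ->; rewrite inE eqxx.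
have xi : `|x|%N \in iota 1 k./2 by rewrite mem_iota add1n ltnS xk absz_gt0 x0.
case: (ltP x 0) => hx; apply/orP; [right|left; apply/orP; right];
  apply/imfsetP; exists `|x|%N => //=.
  by rewrite ltz0_abs // opprK.
by rewrite gez0_abs.
Qed.

Lemma card_Mk (k : nat) : #|` Mk k| = k.
Proof.
rewrite /Mk -fsetUA !cardfsU.
have -> : [fset i%:Z | i in iota 1 k./2] `&` [fset - i%:Z | i in iota 1 k./2]
          = fset0.
  apply/fsetP => x; rewrite !inE; apply/negP => /andP[/imfsetP[i /= hi ->]].
  case/imfsetP => j /= hj; move: hi hj; rewrite !mem_iota.
  by case: i => //; case: j.
have -> : (if odd k then [fset 0] else fset0) `&`
   ([fset i%:Z | i in iota 1 k./2] `|` [fset - i%:Z | i in iota 1 k./2])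
   = fset0.
  apply/fsetP => x; rewrite !inE; apply/negP => /andP[].
  case: (odd k); rewrite !inE // => /eqP -> /orP[] /imfsetP[i /=];
  by rewrite mem_iota; case: i.
rewrite !cardfs0 !subn0 !card_imfset /=; first last.
- by move=> i j [].
- by move=> i j /oppr_inj [].
rewrite !undup_id ?iota_uniq // !size_iota addnn -[RHS]odd_double_half.
by case: (odd k); rewrite ?cardfs1 ?cardfs0.
Qed.

(* Main.v *)
(* Colours are reduced modulo a large prime, so that list colourings become
   maps V -> F_p avoiding the linear equations c u = s * c v, one per edge.
   Removing the edges one by one, with #(avoid e) = #(all) - #(satisfy e),
   and discarding every branch in which a remaining edge is already implied by
   the equations imposed so far, expands the number of colourings over sets A of
   independent equations (those without broken circuit).  If A leaves w vertices
   free, it is satisfied by k^w colourings from M_k (or by none, when k is even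
   and a colour is forced to be 0), and from the lists by at most as many and at
   least k^w - k^(w-1) * sum_(e in A) a(e), where a(e) = k - |L(u) /\ s L(v)|.
   Hence P(L) - P(k) is at least k^(n-2) * sum_e a(e), the contribution of the
   singletons, times 1 - sum_(i odd) C(m-1, i) k^-i.  The last sum is at most
   sinh((m-1)/k) < 1, so P(L) >= P(k), with equality only if every a(e) is 0. *)
Require Import Defs.
From HB Require Import structures.
From mathcomp Require Import all_boot all_order all_algebra.
From mathcomp Require Import finmap.
From mathcomp Require Import boolp classical_sets reals exp.
From mathcomp Require Import sequences.
From mathcomp Require Import zify ring lra.

Set Implicit Arguments.
Unset Strict Implicit.
Unset Printing Implicit Defensive.

Import Order.TTheory GRing.Theory Num.Theory.
Local Open Scope ring_scope.

(** * Even and odd parts of (1 + y)^n, bounded by cosh and sinh *)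

Section HyperbolicParts.
Variable R : realType.
Implicit Types (x y : R) (n : nat).

(** The sum of C(n, i) y^i over the even i; [binom_odd] is the sum over the odd i. *)
Definition binom_even y n : R := ((1 + y) ^+ n + (1 - y) ^+ n) / 2.
Definition binom_odd y n : R := ((1 + y) ^+ n - (1 - y) ^+ n) / 2.

Lemma binom_even0 y : binom_even y 0 = 1.
Proof. by rewrite /binom_even !expr0; field. Qed.

Lemma binom_odd0 y : binom_odd y 0 = 0.
Proof. by rewrite /binom_odd !expr0; field. Qed.

Lemma binom_evenS y n :
  binom_even y n.+1 = binom_even y n + y * binom_odd y n.
Proof. by rewrite /binom_even /binom_odd !exprS; field. Qed.

Lemma binom_oddS y n : binom_odd y n.+1 = binom_odd y n + y * binom_even y n.
Proof. by rewrite /binom_even /binom_odd !exprS; field. Qed.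

Lemma binom_parts_ge0 y n : 0 <= y -> 0 <= binom_even y n /\ 0 <= binom_odd y n.
Proof.
move=> y0; elim: n => [|n [IHe IHo]].
  by rewrite binom_even0 binom_odd0 ler01 lexx.
by rewrite binom_evenS binom_oddS; split; apply: addr_ge0 => //; apply: mulr_ge0.
Qed.

Lemma binom_odd_le y m n : 0 <= y -> (m <= n)%N -> binom_odd y m <= binom_odd y n.
Proof.
move=> y0 /subnK <-; elim: (n - m)%N => [|d IH]; first by rewrite add0n.
rewrite addSn binom_oddS (le_trans IH)// lerDl mulr_ge0//.
by case: (binom_parts_ge0 (d + m) y0).
Qed.

Lemma expR_ge_taylor2 x : 0 <= x -> 1 + x + x ^+ 2 / 2 <= expR x.
Proof.
move=> x0; have -> : 1 + x + x ^+ 2 / 2 = series (exp_coeff x) 3.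
  rewrite /series /= !big_nat_recr //= big_nil /exp_coeff /= /factorial /=.
  by rewrite add0r expr0 expr1 divr1 divr1.
apply: nondecreasing_cvgn_le; last exact: is_cvg_series_exp_coeff.
apply/nondecreasing_seqP => n; rewrite /series /= big_nat_recr//= lerDl.
exact: exp_coeff_ge0.
Qed.

Lemma sinh_ge x : 0 <= x -> 2 * x <= expR x - expR (- x).
Proof.
move=> x0; have q := expR_ge_taylor2 x0; rewrite expRN.
have E0 := expR_gt0 x; rewrite -(ler_pM2r E0) mulrBl mulVf ?gt_eqF//.
(* With E = e^x and T its Taylor polynomial, this gives E^2 - 2xE >= T^2 - 2xT = 1 + x^4/4, whereas
   the claim times E reads E^2 - 2xE >= 1. *)
have h : 0 <= (expR x - (1 + x + x ^+ 2 / 2)) *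
              (expR x + (1 + x + x ^+ 2 / 2) - 2 * x).
  by apply: mulr_ge0; [lra|nra].
have := exprn_ge0 4 x0; nra.
Qed.

Lemma cosh_ge x : 2 <= expR x + expR (- x).
Proof.
have := expR_ge1Dx x; have := expR_ge1Dx (- x); lra.
Qed.

(** The right-hand sides are cosh(ny) and sinh(ny). Their addition formulas have the shape of
    [binom_evenS] and [binom_oddS], with cosh y >= 1 and sinh y >= y in place of the coefficients 1
    and y. *)
Lemma binom_parts_le y n : 0 <= y ->
  binom_even y n <= (expR (n%:R * y) + expR (- (n%:R * y))) / 2 /\
  binom_odd y n <= (expR (n%:R * y) - expR (- (n%:R * y))) / 2.
Proof.
move=> y0; elim: n => [|n [IHe IHo]].
  by rewrite binom_even0 binom_odd0 mul0r oppr0 expR0; split; lra.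
rewrite binom_evenS binom_oddS.
have -> : n.+1%:R * y = n%:R * y + y by rewrite -natr1; ring.
rewrite opprD !expRD.
have sy := sinh_ge y0; have cy := cosh_ge y.
have [] := binom_parts_ge0 n y0.
move: (n%:R * y) IHe IHo => t IHe IHo e0 o0.
have he : y * binom_even y n <=
  (expR y - expR (- y)) / 2 * ((expR t + expR (- t)) / 2).
  by apply: ler_pM => //; lra.
have he' : 1 * binom_even y n <=
  (expR y + expR (- y)) / 2 * ((expR t + expR (- t)) / 2).
  by apply: ler_pM => //; lra.
have ho : y * binom_odd y n <=
  (expR y - expR (- y)) / 2 * ((expR t - expR (- t)) / 2).
  by apply: ler_pM => //; lra.
have ho' : 1 * binom_odd y n <=
  (expR y + expR (- y)) / 2 * ((expR t - expR (- t)) / 2).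
  by apply: ler_pM => //; lra.
by split; lra.
Qed.

(* ln (1 + sqrt 2) is the point where sinh takes the value 1. *)
Lemma binom_odd_lt1 n k : (0 < k)%N ->
  n%:R / ln (1 + Num.sqrt 2) < k%:R :> R -> binom_odd k%:R^-1 n < 1.
Proof.
move=> k0 hk; have K0 : 0 < k%:R :> R by rewrite ltr0n.
have s0 : 0 < Num.sqrt 2 :> R by rewrite sqrtr_gt0.
have s2 : Num.sqrt 2 ^+ 2 = 2 :> R by rewrite sqr_sqrtr.
have l0 : 0 < ln (1 + Num.sqrt 2) :> R by rewrite ln_gt0// ltrDl.
have lt_x : n%:R * k%:R^-1 < ln (1 + Num.sqrt 2) :> R.
  by move: hk; rewrite !ltr_pdivrMr// mulrC.
have y0 : 0 <= k%:R^-1 :> R by rewrite invr_ge0 ltW.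
have [_ /le_lt_trans -> //] := binom_parts_le n y0.
have hE : expR (n%:R * k%:R^-1) < 1 + Num.sqrt 2 :> R.
  by rewrite -(@lnK _ (1 + Num.sqrt 2)) ?ltr_expR// posrE; lra.
move: (n%:R * k%:R^-1) hE => x hE; rewrite expRN.
have E0 := expR_gt0 x.
have hi : Num.sqrt 2 - 1 < (expR x)^-1.
  rewrite -(ltr_pM2r E0) mulVf ?gt_eqF//.
  have : 0 < (Num.sqrt 2 - 1) * (1 + Num.sqrt 2 - expR x).
    by apply: mulr_gt0; nra.
  nra.
by rewrite ltr_pdivrMr//; lra.
Qed.

End HyperbolicParts.

(** * The Weierstrass product inequality *)

Section Weierstrass.
Variables (R : realFieldType) (I : finType) (A : {set I}) (k : nat).
Variable x : I -> nat.
Hypothesis k_gt0 : (0 < k)%N.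
Hypothesis x_le : forall i, i \in A -> (x i <= k)%N.

(** This is prod (1 - d_i) >= 1 - sum d_i for d_i = 1 - x_i/k, multiplied by k^|A|. *)
Lemma prod_defect_bound :
  k%:R ^+ #|A| - (\prod_(i in A) x i)%:R <=
  k%:R ^+ #|A| / k%:R * (\sum_(i in A) (k - x i))%:R :> R.
Proof.
have K0 : 0 < k%:R :> R by rewrite ltr0n.
rewrite cardE -!big_enum /=.
have : {in enum A, forall i, (x i <= k)%N}.
  by move=> i; rewrite mem_enum; apply: x_le.
elim: (enum A) => [|a s IH] xs; first by rewrite !big_nil subrr mulr0.
have xa : (x a <= k)%N by apply: xs; rewrite mem_head.
have {IH xs} IH := IH (fun i is' => xs i (mem_behead (s := a :: s) is')).
rewrite !big_cons natrM natrD natrB//= exprS.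
set P := (\prod_(j <- s) x j)%:R : R in IH *.
set D := (\sum_(j <- s) (k - x j))%:R : R in IH *.
set Q := k%:R ^+ size s in IH *; have Q0 : 0 <= Q by rewrite exprn_ge0// ltW.
have D0 : 0 <= D by rewrite ler0n.
have xa' : (x a)%:R <= k%:R :> R by rewrite ler_nat.
have x0 : 0 <= (x a)%:R :> R by rewrite ler0n.
have {}IH : Q - Q / k%:R * D <= P by lra.
have h : (x a)%:R * (Q - Q / k%:R * D) <= (x a)%:R * P by rewrite ler_wpM2l.
have -> : k%:R * Q / k%:R * (k%:R - (x a)%:R + D) = Q * (k%:R - (x a)%:R + D).
  by field; rewrite gt_eqF.
have h2 : (x a)%:R * (Q / k%:R * D) <= Q * D.
  have -> : Q * D = k%:R * (Q / k%:R * D) by field; rewrite gt_eqF.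
  by rewrite ler_wpM2r// !mulr_ge0// invr_ge0 ltW.
lra.
Qed.

End Weierstrass.

(** * Systems of signed linear equations over a finite field and their elimination *)

Section Constraints.
Variables (V : finType) (F : finFieldType).

(* [(u, v, s)] stands for the equation [c u = s * c v]. *)
Definition constraint := (V * V * F)%type.

(* [st v = (w, s)] expresses the colour of [v] as [s] times the colour of the
   free vertex [w]; [s = 0] means that the colour of [v] is forced to be [0]. *)
Definition state := V -> V * F.

Implicit Types (st : state) (L : V -> {set F}) (c : {ffun V -> F}).
Implicit Types (e : constraint) (es : seq constraint).

Definition tight e c := c e.1.1 == e.2 * c e.1.2.
Definition sat st c := [forall v, c v == (st v).2 * c (st v).1].
Definition pivots st : {set V} := [set w | st w == (w, 1)].
(** Every vertex is forced to 0 or is a sign times a vertex that is itself free, so no chain of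
    substitutions is left to resolve. *)
Definition wf st := forall v,
  (st v).2 = 0 \/ ((st v).2 ^+ 2 = 1 /\ (st v).1 \in pivots st).

(** The colours of the free vertex [w] for which every vertex expressed through [w] gets a colour of
    its own list. Vertices forced to 0 put no condition on [z]; [ncol_nil] treats them
    separately. *)
Definition allowed L st w : {set F} :=
  [set z | [forall v, ((st v).2 != 0) && ((st v).1 == w)
              ==> ((st v).2 * z \in L v)]].

Definition ncol L st es : nat :=
  #|[set c : {ffun V -> F} | [&& [forall v, c v \in L v], sat st c
      & all (fun e => ~~ tight e c) es]]|.

(** Once [st] is substituted, both sides of the equation are the same multiple of one free colour,
    or both are 0. *)
Definition implied st e : bool :=
  ((st e.1.1).2 == e.2 * (st e.1.2).2) &&
  (((st e.1.1).2 == 0) || ((st e.1.1).1 == (st e.1.2).1)).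

Lemma pivotsP st w : reflect (st w = (w, 1)) (w \in pivots st).
Proof. by rewrite inE; apply: eqP. Qed.

Lemma allowed_sub L st w : w \in pivots st -> allowed L st w \subset L w.
Proof.
move/pivotsP=> stw; apply/fintype.subsetP => z; rewrite inE.
by move/forallP/(_ w); rewrite stw /= oner_eq0 eqxx mul1r.
Qed.

(** A solution of [st] is determined by its values at the free vertices, and these vary
    independently; the vertices forced to 0 only need 0 in their lists. *)
Lemma ncol_nil L st : wf st ->
  ncol L st [::] = if [forall v, ((st v).2 == 0) ==> (0 \in L v)]
    then (\prod_(w in pivots st) #|allowed L st w|)%N else 0%N.
Proof.
move=> wst; case: ifPn => [/forallP zL|]; last first.
  rewrite negb_forall => /existsP[v]; rewrite negb_imply => /andP[/eqP s0 zL].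
  apply/eqP; rewrite cards_eq0; apply/eqP/setP => c; rewrite !inE andbT.
  apply/negP => /andP[/forallP /(_ v) cv /forallP /(_ v) /eqP].
  by rewrite s0 mul0r => cv0; rewrite cv0 (negPf zL) in cv.
(* Choices at the free vertices are padded with 0 elsewhere, which makes their number the size of a
   [family]; [f] recovers the colouring. *)
pose D v : {set F} := if v \in pivots st then allowed L st v else [set 0].
pose f (x : {ffun V -> F}) : {ffun V -> F} := [ffun v => (st v).2 * x (st v).1].
have fE x w : w \in pivots st -> f x w = x w.
  by move/pivotsP=> stw; rewrite ffunE stw mul1r.
have -> : (\prod_(w in pivots st) #|allowed L st w|)%N =
          #|[set x : {ffun V -> F} | x \in family (fun v => mem (D v))]|.
  rewrite cardsE card_family foldrE big_map big_enum /= [LHS]big_mkcond /=.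
  by apply: eq_bigr => v _; rewrite /D; case: ifP; rewrite ?cards1.
rewrite -(card_in_imset (f := f)); last first.
  move=> x y; rewrite !inE => /familyP Dx /familyP Dy /ffunP fxy.
  apply/ffunP => v; have := fxy v; have := Dx v; have := Dy v.
  rewrite /D; case: ifPn => [pv _ _|_]; first by rewrite !fE.
  by rewrite !inE => /eqP -> /eqP ->.
congr #|pred_of_set _|; apply/setP => c; rewrite inE andbT; apply/andP/imsetP.
  case=> /forallP cL /forallP cs.
  exists [ffun v => if v \in pivots st then c v else 0].
    rewrite inE; apply/familyP => v; rewrite ffunE /D.
    case: ifP => pv; last by rewrite !inE.
    rewrite inE; apply/forallP => u; apply/implyP => /andP[_ /eqP <-].
    by rewrite -(eqP (cs u)).
  apply/ffunP => v; rewrite !ffunE; case: (wst v) => [s0|[_ ->]].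
    by rewrite (eqP (cs v)) s0 !mul0r.
  exact/eqP.
case=> x; rewrite inE => /familyP Dx ->; split; apply/forallP => v.
  rewrite ffunE; case: (wst v) => [s0|[s1 pv]].
    by rewrite s0 mul0r; have := zL v; rewrite s0 eqxx.
  have := Dx (st v).1; rewrite /D pv inE => /forallP /(_ v).
  rewrite eqxx andbT; case: eqP => // s0; move: s1; rewrite s0 expr0n /=.
  by move/eqP; rewrite eq_sym oner_eq0.
case: (wst v) => [s0|[s1 pv]]; last by rewrite (fE _ _ pv) ffunE.
by rewrite ffunE s0 !mul0r.
Qed.

Lemma sat_implied st e c : sat st c -> implied st e -> tight e c.
Proof.
move=> /forallP cs /andP[/eqP hs /orP[/eqP s0|/eqP hr]]; apply/eqP.
  have h0 : e.2 * (st e.1.2).2 = 0 by rewrite -hs.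
  by rewrite (eqP (cs e.1.1)) (eqP (cs e.1.2)) s0 mul0r mulrA h0 mul0r.
by rewrite (eqP (cs e.1.1)) (eqP (cs e.1.2)) hs hr mulrA.
Qed.

Lemma ncol_implied L st es : has (implied st) es -> ncol L st es = 0%N.
Proof.
case/hasP=> e ees ie; apply/eqP; rewrite cards_eq0; apply/eqP/setP => c.
rewrite !inE; apply/negP => /and3P[_ cs /allP/(_ e ees)].
by rewrite (sat_implied cs ie).
Qed.

(** Colourings are split according to whether [e] is violated or holds; in the second case [e]
    becomes one of the imposed equations, recorded by [st']. *)
Lemma ncol_cons L st st' e es :
  (forall c, sat st' c = sat st c && tight e c) ->
  (ncol L st es = ncol L st (e :: es) + ncol L st' es)%N.
Proof.
move=> sat'; rewrite /ncol -cardsUI; set C := (X in (_ = _ + #|pred_of_set X|)%N).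
have -> : C = finset.set0.
  apply/setP => c; rewrite !inE sat' /=.
  by case: (tight e c); rewrite !(andbF, andbT, andFb).
rewrite cards0 addn0; congr #|pred_of_set _|; apply/setP => c.
rewrite !inE sat' /=; case: [forall v, _] => //=.
by case: (sat st c) => //=; case: (tight e c); rewrite ?orbF.
Qed.

Definition substitute st (a : V) (t : F) (b : V) : state :=
  fun x => if (st x).1 == a then (b, (st x).2 * t) else st x.

(** The choice [t = 0], [b = a] forces the colour of [a] to be 0; otherwise [a] is merged, up to
    sign, into another free vertex [b]. *)
Definition eliminates st (a : V) (t : F) (b : V) :=
  a \in pivots st /\ (t = 0 /\ b = a \/ [/\ t ^+ 2 = 1, b \in pivots st & b != a]).

Lemma pivots_substitute st a t b : wf st -> eliminates st a t b ->
  pivots (substitute st a t b) = pivots st :\ a.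
Proof.
move=> wst [/pivotsP pa hb]; apply/setP => w; rewrite !inE /substitute.
case: (eqVneq w a) => [->|wa] /=.
  rewrite pa /= eqxx mul1r; case: hb => [[-> ->]|[_ _ ba]].
    by rewrite xpair_eqE eqxx eq_sym oner_eq0.
  by rewrite xpair_eqE (negPf ba).
case: (eqVneq (st w).1 a) => // ra.
have -> : (st w == (w, 1)) = false.
  by apply/eqP => stw; move: ra; rewrite stw => /eqP; rewrite (negPf wa).
rewrite xpair_eqE; case: hb => [[-> ->]|[_ /pivotsP pb ba]].
  by rewrite mulr0 eq_sym (negPf wa).
apply/negP => /andP[/eqP bw _]; subst w.
by move: ra; rewrite pb => /eqP; rewrite (negPf wa).
Qed.

Lemma wf_substitute st a t b : wf st -> eliminates st a t b ->
  wf (substitute st a t b).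
Proof.
move=> wst el x; rewrite (pivots_substitute wst el) /substitute.
case: ifPn => [ra|ra] /=; last first.
  by case: (wst x) => [|[s1 px]]; [left|right; rewrite in_setD1 ra px].
case: (wst x) => [->|[s1 px]]; first by left; rewrite mul0r.
case: el => pa [[-> _]|[t1 pb ba]]; first by left; rewrite mulr0.
by right; rewrite exprMn s1 t1 mulr1 in_setD1 ba.
Qed.

Lemma sat_substitute st a t b c : a \in pivots st ->
  sat (substitute st a t b) c = sat st c && (c a == t * c b).
Proof.
move/pivotsP=> pa; apply/forallP/andP => [cs|[/forallP cs /eqP cab] v].
  have /eqP ca := cs a; rewrite /substitute pa eqxx mul1r in ca.
  split; last by rewrite ca.
  apply/forallP => v; have := cs v; rewrite /substitute.
  by case: ifP => // /eqP ->; rewrite ca mulrA.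
rewrite /substitute; case: (eqVneq (st v).1 a) => [ra|_]; last exact: cs.
by rewrite (eqP (cs v)) ra cab mulrA.
Qed.


Definition defect L k st : nat := (\sum_(w in pivots st) (k - #|allowed L st w|))%N.

(** For a sign s this is a(e) = k - |L(u) /\ s L(v)|, counted at v. With all lists of size k it is 0
    only if L(u) = s L(v). *)
Definition conflict L k e : nat :=
  (k - #|[set z in L e.1.2 | (e.2 * z)%R \in L e.1.1]|)%N.

Lemma sqr1_neq0 (t : F) : t ^+ 2 = 1 -> t != 0.
Proof. by apply: contra_eq_neq => ->; rewrite expr0n /= eq_sym oner_eq0. Qed.

Lemma sqr1_mulKr (t x : F) : t ^+ 2 = 1 -> t * (t * x) = x.
Proof. by move=> t1; rewrite mulrA -expr2 t1 mul1r. Qed.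

Lemma allowed_substitute_neq L st a t b w : t = 0 \/ w != b -> w != a ->
  allowed L (substitute st a t b) w = allowed L st w.
Proof.
move=> tb wa; apply/setP => z; rewrite !inE; apply: eq_forallb => x.
rewrite /substitute; case: (eqVneq (st x).1 a) => //= ->.
rewrite [a == w]eq_sym (negPf wa) andbF /=.
by case: tb => [->|wb]; rewrite ?mulr0 ?eqxx // [b == w]eq_sym (negPf wb) andbF.
Qed.

Lemma allowed_substitute_eq L st a t b : t ^+ 2 = 1 -> b != a ->
  allowed L (substitute st a t b) b =
  allowed L st b :&: [set z | t * z \in allowed L st a].
Proof.
move=> /sqr1_neq0 t0 ba; apply/setP => z; rewrite !inE.
apply/forallP/andP => [h|[/forallP hb /forallP ha] x].
  split; apply/forallP => x; apply/implyP => /andP[s0 /eqP rx]; have := h x.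
    by rewrite /substitute rx (negPf ba) rx s0 eqxx.
  by rewrite /substitute rx eqxx /= mulf_neq0 // eqxx mulrA.
rewrite /substitute; case: (eqVneq (st x).1 a) => [ra|ra] /=; last exact: hb.
apply/implyP => /andP[st0 _]; have := ha x; rewrite ra eqxx andbT mulrA.
by have -> : (st x).2 != 0 by apply: contraNneq st0 => ->; rewrite mul0r.
Qed.

Lemma defect_kill L k st a : wf st -> a \in pivots st ->
  (defect L k (substitute st a 0%R a) <= defect L k st)%N.
Proof.
move=> wst pa; rewrite /defect pivots_substitute //; last by split=> //; left.
rewrite [leqRHS](big_setD1 a) //=; apply: leq_trans (leq_addl _ _).
apply: leq_sum => w; rewrite in_setD1 => /andP[wa _].
by rewrite allowed_substitute_neq //; left.
Qed.

Lemma card_scale_set (A : {set F}) t : t ^+ 2 = 1 ->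
  #|[set z | t * z \in A]| = #|A|.
Proof.
move=> t1; rewrite -[RHS](card_imset _ (mulfI (sqr1_neq0 t1))).
congr #|pred_of_set _|; apply/setP => z; rewrite inE.
apply/idP/imsetP => [h|[y yA ->]]; last by rewrite sqr1_mulKr.
by exists (t * z); rewrite ?sqr1_mulKr.
Qed.

(** An element of A /\ B outside X /\ Y lies in A \ X or in B \ Y, and these have k - |X| and k -
    |Y| elements. *)
Lemma cardsI_defect (A B X Y : {set F}) k : X \subset A -> Y \subset B ->
  #|A| = k -> #|B| = k ->
  (k - #|X :&: Y| <= (k - #|X|) + (k - #|Y|) + (k - #|A :&: B|))%N.
Proof.
move=> XA YB cA cB.
have h : A :&: B \subset (X :&: Y) :|: ((A :\: X) :|: (B :\: Y)).
  apply/fintype.subsetP => z; rewrite !inE => /andP[-> ->].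
  by case: (z \in X); case: (z \in Y).
have := leq_trans (subset_leq_card h) (leq_card_setU _ _).
have := (leq_card_setU (A :\: X) (B :\: Y)).1.
rewrite !cardsD (finset.setIidPr XA) (finset.setIidPr YB) cA cB.
lia.
Qed.

(** The new allowed set at [b] is the intersection of the old one with that of [a], transported by
    the sign [t]. By [cardsI_defect] the extra loss is at most that of the lists of the two ends of
    [e], also transported to [b]. *)
Lemma defect_merge L k st e : wf st -> (forall v, #|L v| = k) ->
  (st e.1.1).2 != 0 -> (st e.1.2).2 != 0 -> e.2 ^+ 2 = 1 ->
  (st e.1.2).1 != (st e.1.1).1 ->
  (defect L k (substitute st (st e.1.1).1 ((st e.1.1).2 * e.2 * (st e.1.2).2)%R
                 (st e.1.2).1) <= defect L k st + conflict L k e)%N.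
Proof.
set a := (st e.1.1).1; set b := (st e.1.2).1; set t := _ * _.
move=> wst Lk su0 sv0 s1 ba.
have [su1 pa] : (st e.1.1).2 ^+ 2 = 1 /\ a \in pivots st.
  by case: (wst e.1.1) su0 => [->|//]; rewrite eqxx.
have [sv1 pb] : (st e.1.2).2 ^+ 2 = 1 /\ b \in pivots st.
  by case: (wst e.1.2) sv0 => [->|//]; rewrite eqxx.
have t1 : t ^+ 2 = 1 by rewrite !exprMn su1 s1 sv1 !mulr1.
rewrite /defect pivots_substitute //; last by split=> //; right.
have pb' : b \in pivots st :\ a by rewrite in_setD1 ba.
rewrite (big_setD1 b) //= allowed_substitute_eq //.
rewrite (big_setD1 a pa) (big_setD1 b pb') /=.
rewrite (eq_bigr (fun w => (k - #|allowed L st w|)%N)); last first.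
  move=> w; rewrite !in_setD1 => /and3P[wb wa _].
  by rewrite allowed_substitute_neq //; right.
set X := allowed L st b; set Y := [set z | _].
pose A := [set z | (st e.1.2).2 * z \in L e.1.2].
pose B := [set z | t * z \in [set y | (st e.1.1).2 * y \in L e.1.1]].
have cA : #|A| = k by rewrite card_scale_set.
have cB : #|B| = k by rewrite !card_scale_set.
have XA : X \subset A.
  apply/fintype.subsetP => z; rewrite !inE => /forallP /(_ e.1.2).
  by rewrite sv0 eqxx.
have YB : Y \subset B.
  apply/fintype.subsetP => z; rewrite !inE => /forallP /(_ e.1.1).
  by rewrite su0 eqxx.
(* Multiplication by the sign of the second end carries A /\ B onto the set counted by
   [conflict]. *)
have cAB : #|A :&: B| = #|[set z in L e.1.2 | e.2 * z \in L e.1.1]|.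
  rewrite -[RHS](card_scale_set _ sv1); congr #|pred_of_set _|.
  apply/setP => z; rewrite !inE /t.
  by rewrite -!mulrA sqr1_mulKr.
have cY : #|Y| = #|allowed L st a| by rewrite card_scale_set.
have := cardsI_defect XA YB cA cB; rewrite cAB cY /conflict.
rewrite -(leq_add2r (\sum_(i in pivots st :\ a :\ b) (k - #|allowed L st i|))).
move/leq_trans; apply.
by rewrite [(_ + (k - #|X| + _))%N]addnA addnAC [(_ + (k - #|X|))%N]addnC.
Qed.

(** If one end is forced to 0, or both ends are multiples of one free colour, the equation forces a
    free colour to be 0. Otherwise it merges two free vertices. *)
Lemma eliminate_constraint st e : wf st -> e.2 ^+ 2 = 1 -> ~~ implied st e ->
  exists st', [/\ wf st', forall c, sat st' c = sat st c && tight e c,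
    #|pivots st| = #|pivots st'|.+1
    & forall L k, (forall v, #|L v| = k) ->
        (defect L k st' <= defect L k st + conflict L k e)%N].
Proof.
move=> wst s1 nie.
have kill a : a \in pivots st ->
    (forall c, sat st c -> tight e c = (c a == 0)) ->
  exists st', [/\ wf st', forall c, sat st' c = sat st c && tight e c,
    #|pivots st| = #|pivots st'|.+1
    & forall L k, (forall v, #|L v| = k) ->
        (defect L k st' <= defect L k st + conflict L k e)%N].
  move=> pa ta; have el : eliminates st a 0 a by split=> //; left.
  exists (substitute st a 0 a); split.
  - exact: wf_substitute.
  - move=> c; rewrite sat_substitute // mul0r.
    by apply: andb_id2l => /ta ->.
  - by rewrite pivots_substitute // (cardsD1 a (pivots st)) pa.
  - by move=> L k _; apply: leq_trans (defect_kill _ _ wst pa) (leq_addr _ _).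
have satE c v : sat st c -> c v = (st v).2 * c (st v).1.
  by move/forallP/(_ v)/eqP.
have s0 := sqr1_neq0 s1.
have piv v : (st v).2 != 0 -> (st v).2 ^+ 2 = 1 /\ (st v).1 \in pivots st.
  by case: (wst v) => [->|//]; rewrite eqxx.
case: (eqVneq (st e.1.1).2 0) => [su0|su0].
  have sv0 : (st e.1.2).2 != 0.
    apply: contra nie => /eqP sv0.
    by rewrite /implied su0 sv0 mulr0 eqxx.
  apply: (kill _ (piv _ sv0).2) => c cs; rewrite /tight (satE c _ cs) su0 mul0r.
  by rewrite (satE c e.1.2 cs) eq_sym !mulf_eq0 (negPf s0) (negPf sv0).
case: (eqVneq (st e.1.2).2 0) => [sv0|sv0].
  apply: (kill _ (piv _ su0).2) => c cs; rewrite /tight (satE c _ cs).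
  by rewrite (satE c e.1.2 cs) sv0 mul0r mulr0 mulf_eq0 (negPf su0).
case: (eqVneq (st e.1.2).1 (st e.1.1).1) => [ba|ba].
  (* The equation reads (difference of the two coefficients) times the free colour = 0, and the
     difference is nonzero because [e] is not implied. *)
  apply: (kill _ (piv _ su0).2) => c cs; rewrite /tight (satE c _ cs).
  rewrite (satE c e.1.2 cs) ba -subr_eq0 mulrA -mulrBl mulf_eq0 subr_eq0.
  by move: nie; rewrite /implied ba eqxx orbT andbT => /negPf ->.
have [su1 pa] := piv _ su0; have [sv1 pb] := piv _ sv0.
set t := (st e.1.1).2 * e.2 * (st e.1.2).2.
have el : eliminates st (st e.1.1).1 t (st e.1.2).1.
  by split=> //; right; split=> //; rewrite !exprMn su1 s1 sv1 !mulr1.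
exists (substitute st (st e.1.1).1 t (st e.1.2).1); split.
- exact: wf_substitute.
- move=> c; rewrite sat_substitute //; apply: andb_id2l => cs.
  rewrite /tight (satE c e.1.1 cs) (satE c e.1.2 cs) /t.
  by rewrite -(inj_eq (mulfI su0)) -!mulrA sqr1_mulKr.
- by rewrite pivots_substitute // (cardsD1 (st e.1.1).1 (pivots st)) pa.
- by move=> L k Lk; apply: defect_merge.
Qed.

End Constraints.

(** * Comparison of the lists [L] with a constant list [M] closed under negation *)

Section Comparison.
Variables (R : realType) (V : finType) (F : finFieldType) (k : nat).
Variables (L : V -> {set F}) (M : {set F}).
Hypothesis k_gt0 : (0 < k)%N.
Hypothesis card_L : forall v, #|L v| = k.
Hypothesis card_M : #|M| = k.
Hypothesis M_opp : forall z, z \in M -> - z \in M.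
Hypothesis zero_LM : forall v, (0 \in L v) = (0 \in M).

Implicit Types (st : state V F) (e : constraint V F) (es : seq (constraint V F)).

Local Notation K := (k%:R : R).
Local Notation y := (K^-1).
Local Notation ev n := (binom_even y n).
Local Notation od n := (binom_odd y n).

(** Oriented so as to be nonnegative when no edge is left to violate ([gap_nil_bounds]); the aim is
    that it is at most 0 at [start]. *)
Definition gap st es : R := (ncol (fun=> M) st es)%:R - (ncol L st es)%:R.

Definition conflicts es : R := (\sum_(e <- es) conflict L k e)%:R.

Let K_gt0 : 0 < K. Proof. by rewrite ltr0n. Qed.
Let y_ge0 : 0 <= y. Proof. by rewrite invr_ge0 ltW. Qed.
Let ev_ge0 n : 0 <= ev n. Proof. by case: (binom_parts_ge0 n y_ge0). Qed.
Let od_ge0 n : 0 <= od n. Proof. by case: (binom_parts_ge0 n y_ge0). Qed.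
Let pow_ge0 n : 0 <= K ^+ n. Proof. by rewrite exprn_ge0// ltW. Qed.

Lemma conflicts_ge0 es : 0 <= conflicts es. Proof. exact: ler0n. Qed.

Lemma conflicts_cons e es :
  conflicts (e :: es) = (conflict L k e)%:R + conflicts es.
Proof. by rewrite /conflicts big_cons natrD. Qed.

Lemma M_sign (t z : F) : t ^+ 2 = 1 -> z \in M -> t * z \in M.
Proof.
move=> /eqP; rewrite sqrf_eq1 => /orP[]/eqP-> zM; first by rewrite mul1r.
by rewrite mulN1r M_opp.
Qed.

(** Since [M] is closed under signs, imposing equations costs no colours at the remaining free
    vertices. *)
Lemma allowed_M st w : wf st -> w \in pivots st -> allowed (fun=> M) st w = M.
Proof.
move=> wst pw; apply/eqP; rewrite finset.eqEsubset allowed_sub //=.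
apply/fintype.subsetP => z zM; rewrite inE; apply/forallP => v.
apply/implyP => /andP[s0 _]; case: (wst v) s0 => [->|[s1 _] _].
  by rewrite eqxx.
exact: M_sign.
Qed.

Lemma gap_nil st : wf st -> gap st [::] =
  if [forall v, ((st v).2 == 0) ==> (0 \in M)]
  then K ^+ #|pivots st| - (\prod_(w in pivots st) #|allowed L st w|)%:R else 0.
Proof.
move=> wst; rewrite /gap !ncol_nil //.
have -> : [forall v, ((st v).2 == 0) ==> (0 \in L v)] =
          [forall v, ((st v).2 == 0) ==> (0 \in M)].
  by apply: eq_forallb => v; rewrite zero_LM.
case: ifP => _; last by rewrite subrr.
rewrite (eq_bigr (fun=> k)); last by move=> w pw; rewrite allowed_M.
by rewrite prod_nat_const natrX.
Qed.

Lemma card_allowed st w : w \in pivots st -> (#|allowed L st w| <= k)%N.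
Proof. by move=> pw; rewrite -(card_L w) subset_leq_card // allowed_sub. Qed.

Lemma gap_nil_bounds st : wf st ->
  0 <= gap st [::] <= K ^+ #|pivots st| / K * (defect L k st)%:R.
Proof.
move=> wst; rewrite gap_nil //; case: ifP => _; last first.
  by rewrite lexx !mulr_ge0.
rewrite prod_defect_bound //; last by move=> i; apply: card_allowed.
rewrite andbT subr_ge0 -natrX ler_nat -prod_nat_const.
by apply: leq_prod => w; apply: card_allowed.
Qed.

(** Expanding over the sets A of further imposed edges, [up] bounds the terms with |A| even and [dn]
    those with |A| odd. A given edge e contributes its conflict to each A containing it, and the
    rest of A is chosen among [(size es).-1] edges with the opposite parity. The third bound keeps
    the term of the empty set, which is present only if no remaining edge is implied. *)
Lemma gap_bounds es st : wf st -> {in es, forall e, e.2 ^+ 2 = 1} ->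
  let up := K ^+ #|pivots st| / K * ((defect L k st)%:R * ev (size es)
              + conflicts es * y * od (size es).-1) in
  let dn := K ^+ #|pivots st| / K * ((defect L k st)%:R * od (size es)
              + conflicts es * y * ev (size es).-1) in
  [/\ gap st es <= up, - gap st es <= dn
    & ~~ has (implied st) es -> gap st [::] - gap st es <= dn].
Proof.
elim: es st => [|e es IH] st wst sgn up dn.
  have /andP[g0 g1] := gap_nil_bounds wst.
  have upE : up = K ^+ #|pivots st| / K * (defect L k st)%:R.
    by rewrite /up /conflicts big_nil binom_even0 !mul0r addr0 mulr1.
  have dnE : dn = 0.
    by rewrite /dn /conflicts big_nil binom_odd0 !mul0r addr0 !mulr0.
  by rewrite upE dnE subrr oppr_le0; split.
have nonneg n1 n2 n3 (x z : R) : 0 <= x -> 0 <= z ->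
    0 <= K ^+ n1 / K * (n2%:R * x + n3%:R * y * z).
  by move=> x0 z0; rewrite mulr_ge0 ?mulr_ge0// addr_ge0 ?mulr_ge0.
have up0 : 0 <= up by apply: nonneg.
have dn0 : 0 <= dn by apply: nonneg.
case: (boolP (has (implied st) (e :: es))) => [imp|nimp].
  by rewrite /gap !(ncol_implied _ imp) subrr oppr0; split.
have /andP[g0 _] := gap_nil_bounds wst.
move: (nimp); rewrite /= negb_or => /andP[ne nes].
have sgn' : {in es, forall e, e.2 ^+ 2 = 1}.
  by move=> f fes; apply: sgn; rewrite inE fes orbT.
have [st' [wst' sat' piv' def']] :=
  eliminate_constraint wst (sgn e (mem_head _ _)) ne.
have gapE : gap st (e :: es) = gap st es - gap st' es.
  by rewrite /gap !(ncol_cons _ es sat') !natrD; ring.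
have [u1 d1 n1] := IH st wst sgn'; have {n1} n1 := n1 nes.
have {IH} [u2 d2 _] := IH st' wst' sgn'.
have {def'} dd :
    (defect L k st')%:R <= (defect L k st)%:R + (conflict L k e)%:R :> R.
  by rewrite -natrD ler_nat def'.
suff: gap st (e :: es) <= up /\ gap st [::] - gap st (e :: es) <= dn.
  by case=> h1 h2; split=> //; move: g0 h2; lra.
rewrite /up /dn {up dn up0 dn0} gapE conflicts_cons /= binom_evenS binom_oddS.
move: u1 n1 u2 d2; rewrite {d1} piv' exprSr mulfK ?gt_eqF //.
set Q := K ^+ _; set D := (defect L k st)%:R in dd *.
set D' := (defect L k st')%:R in dd *; set a := (conflict L k e)%:R in dd *.
set A := conflicts es; have Q0 : 0 <= Q := pow_ge0 _.
(* For empty [es] the truncated [(size es).-1] breaks the recursion, but then the factor [A] is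
   0. *)
have hA1 : A * (od (size es).-1 + y * ev (size es).-1) = A * od (size es).
  rewrite /A; case: es {nimp nes sgn sgn' A} => [|f s].
    by rewrite /conflicts big_nil !mul0r.
  by rewrite /= binom_oddS.
have hA2 : A * (ev (size es).-1 + y * od (size es).-1) = A * ev (size es).
  rewrite /A; case: es {nimp nes sgn sgn' A hA1} => [|f s].
    by rewrite /conflicts big_nil !mul0r.
  by rewrite /= binom_evenS.
move=> u1 n1 u2 d2; split.
  have -> : Q * (D * (ev (size es) + y * od (size es)) + (a + A) * y * od (size es))
    = Q * (D * ev (size es) + A * y * od (size es).-1)
      + Q / K * ((D + a) * od (size es) + A * y * ev (size es).-1).
    rewrite (_ : (a + A) * y * od (size es) = a * y * od (size es)
                 + y * (A * od (size es))); last by ring.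
    by rewrite -hA1; ring.
  rewrite lerD // (le_trans d2) // ler_wpM2l ?mulr_ge0 // lerD2r.
  by rewrite ler_wpM2r.
have -> : Q * (D * (od (size es) + y * ev (size es)) + (a + A) * y * ev (size es))
  = Q * (D * od (size es) + A * y * ev (size es).-1)
    + Q / K * ((D + a) * ev (size es) + A * y * od (size es).-1).
  rewrite (_ : (a + A) * y * ev (size es) = a * y * ev (size es)
                 + y * (A * ev (size es))); last by ring.
    by rewrite -hA2; ring.
rewrite opprB addrCA addrC lerD // (le_trans u2) // ler_wpM2l ?mulr_ge0 //.
by rewrite lerD2r ler_wpM2r.
Qed.

Definition start : state V F := fun v => (v, 1).

Lemma pivots_start : pivots start = [set: V].
Proof. by apply/setP => v; rewrite !inE eqxx. Qed.

Lemma wf_start : wf start.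
Proof. by move=> v; right; rewrite expr1n pivots_start inE. Qed.

Lemma allowed_start w : allowed L start w = L w.
Proof.
apply/setP => z; rewrite inE; apply/forallP/idP => [/(_ w)|zL v] /=.
  by rewrite oner_eq0 eqxx mul1r.
by rewrite oner_eq0 mul1r /=; apply/implyP => /eqP ->.
Qed.

(** For a sign s, [c u = s * c v] and [c v = s * c u] are one equation written in two ways. *)
Definition same_constraint e e' : bool :=
  (e' == e) || (e' == (e.1.2, e.1.1, e.2)).

(** * The state after a single equation has been imposed *)

Section FirstStep.
Variable e : constraint V F.
Hypothesis e_sign : e.2 ^+ 2 = 1.
Hypothesis e_neq : e.1.1 != e.1.2.
Let st1 := substitute start e.1.1 e.2 e.1.2.

Lemma eliminates_start : eliminates start e.1.1 e.2 e.1.2.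
Proof. by split; rewrite pivots_start ?inE //; right; rewrite eq_sym. Qed.

Lemma wf_first : wf st1.
Proof. exact: wf_substitute wf_start eliminates_start. Qed.

Lemma pivots_first : pivots st1 = [set: V] :\ e.1.1.
Proof. by rewrite (pivots_substitute wf_start eliminates_start) pivots_start. Qed.

Lemma card_first : #|V| = #|pivots st1|.+1.
Proof. by rewrite pivots_first -cardsT (cardsD1 e.1.1) inE. Qed.

Lemma sat_first c : sat st1 c = sat start c && tight e c.
Proof. by rewrite sat_substitute // pivots_start inE. Qed.

Lemma allowed_first : allowed L st1 e.1.2 = [set z in L e.1.2 | e.2 * z \in L e.1.1].
Proof.
rewrite allowed_substitute_eq ?[_ == e.1.1]eq_sym // !allowed_start.
by apply/setP => z; rewrite !inE.
Qed.

Lemma allowed_first_neq w : w != e.1.1 -> w != e.1.2 -> allowed L st1 w = L w.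
Proof.
by move=> w1 w2; rewrite allowed_substitute_neq ?allowed_start //; right.
Qed.

Lemma pivot_first : e.1.2 \in pivots st1.
Proof. by rewrite pivots_first !inE eq_sym e_neq. Qed.

Lemma defect_first : defect L k st1 = conflict L k e.
Proof.
rewrite /defect (big_setD1 _ pivot_first) /= allowed_first big1 ?addn0 // => w.
rewrite pivots_first !inE => /and3P[w2 w1 _].
by rewrite allowed_first_neq // card_L subnn.
Qed.

(** The exact contribution of the singleton of [e]: among the n - 1 free vertices only [e.1.2] loses
    colours, namely [conflict L k e] of them. *)
Lemma gap_first : gap st1 [::] =
  K ^+ #|V| / K / K * (conflict L k e)%:R.
Proof.
rewrite (gap_nil wf_first) ifT; last first.
  apply/forallP => v; rewrite /st1 /substitute /=; case: ifP => _ /=.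
    by rewrite mul1r (negPf (sqr1_neq0 e_sign)).
  by rewrite oner_eq0.
rewrite (big_setD1 _ pivot_first) /= allowed_first.
rewrite (eq_bigr (fun=> k)); last first.
  move=> w; rewrite pivots_first !inE => /and3P[w2 w1 _].
  by rewrite allowed_first_neq.
rewrite prod_nat_const natrM natrX card_first (cardsD1 e.1.2 (pivots st1)).
rewrite pivot_first add1n !exprS /conflict natrB; last first.
  rewrite -(card_L e.1.2) subset_leq_card //.
  by apply/fintype.subsetP => z; rewrite inE => /andP[].
by field; rewrite gt_eqF.
Qed.

(** No colour is forced to 0, and only the two ends of [e] are expressed through a common vertex. So
    an implied [e'] has the same ends, and the coefficients then give the same sign. *)
Lemma first_not_implied e' : e'.1.1 != e'.1.2 ->
  ~~ same_constraint e e' -> ~~ implied st1 e'.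
Proof.
case: e' => [[u v] s] /= uv; apply: contra => /andP[/eqP].
rewrite /st1 /substitute /same_constraint /=.
case: e e_sign e_neq => [[u0 v0] s0] /= s1 n0.
rewrite !xpair_eqE.
case: (eqVneq u u0) => [uu|uu]; case: (eqVneq v u0) => [vu|vu] /=.
- by move: uv; rewrite uu vu eqxx.
- rewrite mul1r mulr1 => <-; rewrite (negPf (sqr1_neq0 s1)) /=.
  by move/eqP=> ->; rewrite !eqxx.
- rewrite mul1r => ss; rewrite oner_eq0 /= => ->; rewrite /=.
  by rewrite -[s]mulr1 -s1 expr2 mulrA -ss mul1r.
by rewrite oner_eq0 (negPf uv).
Qed.

End FirstStep.

Lemma gap_start_nil : gap start [::] = 0.
Proof.
have /andP[g0] := gap_nil_bounds wf_start; rewrite /defect big1 ?mulr0 => [g1|w _].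
  by apply/eqP; rewrite eq_le g0 g1.
by rewrite allowed_start card_L subnn.
Qed.

(** The branch that imposes [e] contributes at least [gap_first] minus the [dn] of [gap_bounds],
    whose third bound applies because [e] alone implies no later edge. The recursion of [binom_odd]
    makes these contributions add up to a single factor 1 - [od (size es).-1]. *)
Lemma gap_start_bound es : {in es, forall e, e.2 ^+ 2 = 1} ->
  {in es, forall e, e.1.1 != e.1.2} ->
  pairwise (fun e e' => ~~ same_constraint e e') es ->
  K ^+ #|V| / K / K * (conflicts es * (1 - od (size es).-1)) <= - gap start es.
Proof.
elim: es => [|e es IH] sgn neq.
  by rewrite gap_start_nil /conflicts big_nil mul0r mulr0 oppr0.
rewrite pairwise_cons => /andP[/allP nsame pw].
have sgn' : {in es, forall e, e.2 ^+ 2 = 1}.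
  by move=> f fes; apply: sgn; rewrite inE fes orbT.
have neq' : {in es, forall e, e.1.1 != e.1.2}.
  by move=> f fes; apply: neq; rewrite inE fes orbT.
have {IH} := IH sgn' neq' pw.
have e_sign := sgn e (mem_head _ _); have e_neq := neq e (mem_head _ _).
set st1 := substitute start e.1.1 e.2 e.1.2.
have nimp : ~~ has (implied st1) es.
  apply/hasPn => f fes; apply: first_not_implied => //; first exact: neq'.
  exact: nsame.
have [_ _ /(_ nimp)] := gap_bounds (wf_first e_sign e_neq) sgn'.
have -> : gap start (e :: es) = gap start es - gap st1 es.
  by rewrite /gap !(ncol_cons _ es (sat_first e)) !natrD; ring.
rewrite -/st1 gap_first // defect_first // (card_first e_sign e_neq) -/st1.
rewrite exprSr mulfK ?gt_eqF // conflicts_cons /=.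
set Q := K ^+ _ / K; set a := (conflict L k e)%:R; set A := conflicts es.
have hA : A * (od (size es).-1 + y * ev (size es).-1) = A * od (size es).
  rewrite /A; case: es {nimp nsame pw sgn sgn' neq neq' A} => [|f s].
    by rewrite /conflicts big_nil !mul0r.
  by rewrite /= binom_oddS.
have -> : Q * ((a + A) * (1 - od (size es))) =
    Q * (A * (1 - od (size es).-1)) +
    (Q * a - Q * (a * od (size es) + A * y * ev (size es).-1)).
  by rewrite mulrDl [A * (1 - od (size es))]mulrBr -hA; ring.
lra.
Qed.

Lemma ncol_compare es : {in es, forall e, e.2 ^+ 2 = 1} ->
  {in es, forall e, e.1.1 != e.1.2} ->
  pairwise (fun e e' => ~~ same_constraint e e') es ->
  od (size es).-1 < 1 ->
  (ncol (fun=> M) start es <= ncol L start es)%N /\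
  (ncol L start es = ncol (fun=> M) start es ->
   {in es, forall e, conflict L k e = 0%N}).
Proof.
move=> sgn neq pw od1; have := gap_start_bound sgn neq pw.
have Q0 : 0 < K ^+ #|V| / K / K by rewrite !divr_gt0 // exprn_gt0.
have o0 : 0 < 1 - od (size es).-1 by rewrite subr_gt0.
move=> b; split=> [|eqn e ees].
  rewrite -(ler_nat R) -subr_le0 -oppr_ge0; apply: le_trans b.
  by rewrite mulr_ge0 ?(ltW Q0) // mulr_ge0 ?conflicts_ge0 // ltW.
move: b; rewrite /gap eqn subrr oppr0 pmulr_rle0 // pmulr_lle0 //.
rewrite lern0 => /eqP /eqP; rewrite sum_nat_seq_eq0 => /allP /(_ e ees).
by move/eqP.
Qed.

End Comparison.

(** * Integer colours reduced modulo a large prime *)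

Lemma intr_Fp_inj (p N : nat) (x y : int) : prime p -> (N + N < p)%N ->
  (`|x| <= N)%N -> (`|y| <= N)%N -> x%:~R = y%:~R :> 'F_p -> x = y.
Proof.
move=> pp Np xN yN /eqP; rewrite -subr_eq0 -intrB => /eqP xy0.
have dvd : (p %| `|x - y|)%N.
  rewrite (dvdn_pcharf (pchar_Fp pp)); case: (x - y) xy0 => n /=.
    by move=> h; rewrite -[n%:R]/(n%:Z%:~R) h.
  by rewrite NegzE => /eqP; rewrite mulrNz oppr_eq0.
have lt : (`|x - y| < p)%N by lia.
apply/eqP; rewrite -subr_eq0 -absz_eq0; apply: contraLR dvd.
by rewrite -lt0n => /gtnNdvd ->.
Qed.

(** Serves to keep one edge from each class of parallel edges of equal sign, as the comparison
    requires pairwise distinct equations. *)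
Lemma uniq_image_subseq (T : Type) (U : eqType) (f : T -> U) (s : seq T) :
  exists s', [/\ uniq (map f s'), map f s' =i map f s & (size s' <= size s)%N].
Proof.
elim: s => [|x s [s' [us ms sz]]]; first by exists [::].
case: (boolP (f x \in map f s)) => fx; [exists s'|exists (x :: s')].
  split=> //; last exact: leqW.
  by move=> z; rewrite ms inE; case: eqP => // ->.
by split=> //=; rewrite ?ms ?fx // => z; rewrite !inE ms.
Qed.

Definition residues (p : nat) (A : {fset int}) : {set 'F_p} :=
  [set z | z \in [seq x%:~R | x <- enum_fset A]].

Section Residues.
Variables (p N : nat).
Hypotheses (p_prime : prime p) (N_lt : (N + N < p)%N).
Implicit Types A : {fset int}.

Definition bounded A := forall x, x \in A -> (`|x| <= N)%N.

Lemma residuesP A (z : 'F_p) :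
  reflect (exists2 x, x \in A & z = x%:~R) (z \in residues p A).
Proof. by rewrite inE; apply: (iffP mapP). Qed.

Lemma mem_residues A x : bounded A -> (`|x| <= N)%N ->
  (x%:~R \in residues p A) = (x \in A).
Proof.
move=> bA xN; apply/residuesP/idP => [[y yA /intr_Fp_inj xy]|xA].
  by rewrite (xy N) // bA.
by exists x.
Qed.

Lemma card_residues A : bounded A -> #|residues p A| = #|` A|.
Proof.
move=> bA; rewrite cardsE.
have /card_uniqP -> : uniq [seq x%:~R : 'F_p | x <- enum_fset A].
  rewrite map_inj_in_uniq ?fset_uniq // => x y xA yA.
  by apply: (intr_Fp_inj p_prime N_lt); apply: bA.
by rewrite size_map.
Qed.

End Residues.

(** * List colourings of signed graphs as solutions of systems modulo p *)

Section SignedGraphTheory.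
Variable S : signed_graph.
Local Notation V := (vertex S).
Local Notation E := (edge S).
Implicit Types (L : V -> {fset int}) (e : E).

Lemma sigma_sqr e : sigma e ^+ 2 = 1.
Proof. by case: (sigma_sign e) => ->. Qed.

Lemma sigma_mulK e x : sigma e * (sigma e * x) = x.
Proof. by rewrite mulrA -expr2 sigma_sqr mul1r. Qed.

Lemma absz_sigma e : `|sigma e|%N = 1%N.
Proof. by case: (sigma_sign e) => ->. Qed.

Lemma scaleP s A z : reflect (exists2 x, x \in A & z = s * x) (z \in scale s A).
Proof. exact: imfsetP. Qed.

Lemma scaleM s t A : scale s (scale t A) = scale (s * t) A.
Proof.
apply/fsetP => z; apply/scaleP/scaleP => [[x /scaleP[y yA ->] ->]|[x xA ->]].
  by exists y; rewrite ?mulrA.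
by exists (t * x); rewrite ?mulrA //; apply/scaleP; exists x.
Qed.

Lemma scale1 A : scale 1 A = A.
Proof.
apply/fsetP => z; apply/scaleP/idP => [[x xA ->]|zA]; first by rewrite mul1r.
by exists z; rewrite ?mul1r.
Qed.

Lemma scale_sigmaK e A : scale (sigma e) (scale (sigma e) A) = A.
Proof. by rewrite scaleM -expr2 sigma_sqr scale1. Qed.

Lemma endpoints_ex : exists f : E -> V * V, forall e,
  ends e = [set (f e).1; (f e).2]%SET /\ (f e).1 != (f e).2.
Proof.
have h e : exists w : V * V, ends e = [set w.1; w.2]%SET /\ w.1 != w.2.
  have /cards2P[u [v [uv ->]]] : #|ends e| == 2 by rewrite card_ends.
  by exists (u, v).
by have [f fP] := choice h; exists f.
Qed.

Section ListColoringsModP.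
Variables (f : E -> V * V) (p N : nat) (es : seq E).
Hypothesis endsE : forall e, ends e = [set (f e).1; (f e).2]%SET.
Hypothesis f_neq : forall e, (f e).1 != (f e).2.
Hypotheses (p_prime : prime p) (N_lt : (N + N < p)%N) (N_gt0 : (0 < N)%N).
Let key e := (ends e, sigma e).
Hypothesis es_uniq : uniq (map key es).
Hypothesis es_all : forall e, exists2 e', e' \in es & key e' = key e.

Definition constraint_of e : constraint V 'F_p := (f e, (sigma e)%:~R).

(** Both sides of an edge equation have absolute value at most [N], so reduction modulo [p] neither
    creates nor loses equalities. The orientation chosen by [f] is harmless because signs are
    involutions. *)
Lemma proper_coloringE (c : V -> int) : (forall v, `|c v| <= N)%N ->
  proper_coloring c = all (fun q => ~~ tight q [ffun v => (c v)%:~R : 'F_p])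
                        (map constraint_of es).
Proof.
move=> cN; have tightE e : tight (constraint_of e) [ffun v => (c v)%:~R : 'F_p]
    = (c (f e).1 == sigma e * c (f e).2).
  rewrite /tight /= !ffunE -intrM; apply/eqP/eqP => [|-> //].
  by apply: (intr_Fp_inj p_prime N_lt); rewrite ?abszM ?absz_sigma ?mul1n.
apply/idP/allP => [/forallP h _ /mapP[e _ ->]|h].
  rewrite tightE; have /forallP/(_ (f e).1)/forallP/(_ (f e).2) := h e.
  by rewrite /joins -endsE eqxx.
apply/forallP => e; apply/forallP => u; apply/forallP => v; apply/implyP.
have [e' e'es [ee sE]] := es_all e; rewrite /joins => /eqP ends_e.
have := h _ (map_f constraint_of e'es); rewrite tightE sE.
have := endsE e'; rewrite ee ends_e => /setP uv.
have := uv (f e').1; have := uv (f e').2; rewrite !inE !eqxx orbT /=.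
have := f_neq e'.
move=> neq /orP[]/eqP e2 /orP[]/eqP e1; rewrite e1 e2 ?eqxx // in neq *.
by apply: contraNneq => ->; rewrite sigma_mulK.
Qed.

Lemma P_list_ncol L : (forall v, bounded N (L v)) ->
  P_list L = ncol (fun v => residues p (L v)) (@start V 'F_p) (map constraint_of es).
Proof.
move=> bL; pose g (c : {dffun forall v : V, L v}) : {ffun V -> 'F_p} :=
  [ffun v => (val (c v))%:~R].
have g_inj : injective g.
  move=> c d /ffunP cd; apply/ffunP => v; apply: val_inj.
  by have := cd v; rewrite !ffunE; apply: (intr_Fp_inj p_prime N_lt); apply/bL/valP.
rewrite /P_list /ncol -(card_imset _ g_inj); congr #|pred_of_set _|.
have bc (c : {dffun forall v : V, L v}) v : (`|val (c v)| <= N)%N.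
  by apply/bL/valP.
apply/setP => h; rewrite inE; apply/imsetP/and3P => [[c]|[/forallP hL _ ph]].
  rewrite inE => pc ->; split.
  - by apply/forallP => v; rewrite ffunE (mem_residues p_prime N_lt) //; apply: valP.
  - by apply/forallP => v; rewrite mul1r.
  - by rewrite -proper_coloringE.
(* An integer preimage in the list is picked at each vertex to lift [h] to a list colouring. *)
have hx v : {x : L v | h v == (val x)%:~R}.
  apply: sigW; have /residuesP[x xL ->] := hL v.
  by exists [` xL]%fset.
pose c : {dffun forall v : V, L v} := [ffun v => sval (hx v)].
have hE : h = g c.
  by apply/ffunP => v; rewrite !ffunE; apply/eqP/(svalP (hx v)).
by exists c => //; rewrite inE proper_coloringE // -/(g c) -hE.
Qed.

(** As 0 < [N] and 2 [N] < [p], the residues of 1 and -1 differ, so a constraint, in either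
    orientation, determines the ends and the sign of its edge. *)
Lemma constraints_distinct :
  pairwise (fun q q' => ~~ same_constraint q q') (map constraint_of es).
Proof.
rewrite pairwise_map; move: es_uniq; rewrite uniq_pairwise pairwise_map.
apply: sub_pairwise => e e' /=; apply: contraNN => same.
suff [h hs] : ends e = ends e' /\ sigma e = sigma e' by rewrite /key h hs.
rewrite !endsE; case/orP: same => /eqP[].
  move=> -> /esym sE; split=> //.
  by apply: (intr_Fp_inj p_prime N_lt) sE; rewrite absz_sigma.
move=> -> /esym sE; split=> /=; first by rewrite finset.setUC.
by apply: (intr_Fp_inj p_prime N_lt) sE; rewrite absz_sigma.
Qed.

End ListColoringsModP.

Lemma list_bound_ex L : exists N, forall v, bounded N (L v).
Proof.
exists (\max_v \max_(x <- enum_fset (L v)) `|x|)%N => v x xL.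
apply: leq_trans (leq_bigmax v).
exact: (@leq_bigmax_seq int (enum_fset (L v)) predT absz x xL isT).
Qed.

Lemma list_coloring_compare (R : realType) (k : nat) L : (0 < k)%N ->
  (#|E|%:R - 1) / ln (1 + Num.sqrt 2) < k%:R :> R ->
  k_assignment k L -> (forall v, (0 \in L v) = odd k) ->
  (P_Sigma S k <= P_list L)%N /\
  (P_list L = P_Sigma S k -> forall e (u v : V),
     joins e u v -> L v = scale (sigma e) (L u)).
Proof.
move=> k0 kgt Lk L0; have [f fP] := endpoints_ex.
have endsE e : ends e = [set (f e).1; (f e).2]%SET by case: (fP e).
have f_neq e : (f e).1 != (f e).2 by case: (fP e).
(* [N] must bound the colours of [Mk k] as well as those of the lists; [k] is enough for the
   former. *)
have [N0 bL0] := list_bound_ex L; pose N := maxn N0 k.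
have N_gt0 : (0 < N)%N by rewrite leq_max k0 orbT.
have bL v : bounded N (L v).
  by move=> x xL; rewrite leq_max (bL0 v).
have bM : bounded N (Mk k).
  move=> x; rewrite in_Mk => /andP[xk _]; rewrite leq_max; apply/orP; right.
  by apply: leq_trans xk _; rewrite leq_half_double -addnn leqW // leq_addr.
have [p N_lt p_prime] := prime_above (N + N).
have [es [es_uniq es_mem es_size]] :=
  uniq_image_subseq (fun e : E => (ends e, sigma e)) (enum E).
have es_all e : exists2 e', e' \in es & (ends e', sigma e') = (ends e, sigma e).
  have : (ends e, sigma e) \in [seq (ends e, sigma e) | e <- es].
    by rewrite es_mem (map_f (fun e => (ends e, sigma e))) ?mem_enum.
  by case/mapP => e' e'es h; exists e'.
pose cs := map (constraint_of f p) es.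
have sgn : {in cs, forall q, q.2 ^+ 2 = 1}.
  by move=> _ /mapP[e _ ->] /=; rewrite -rmorphXn sigma_sqr.
have neq : {in cs, forall q, q.1.1 != q.1.2} by move=> _ /mapP[e _ ->] /=.
have pw := constraints_distinct endsE p_prime N_lt N_gt0 es_uniq.
have od1 : binom_odd (k%:R : R)^-1 (size cs).-1 < 1.
  (* Discarding repeated edges can only lower the index, in which [binom_odd] is nondecreasing. *)
  apply: (@le_lt_trans _ _ (binom_odd (k%:R : R)^-1 #|E|.-1)).
    apply: binom_odd_le; first by rewrite invr_ge0 ler0n.
    by rewrite size_map -!subn1 leq_sub2r // (leq_trans es_size) // cardE.
  (* Without edges the hypothesis involves m - 1 = -1 but the index is truncated to 0, where
     [binom_odd] vanishes. *)
  case: #|E| kgt => [_|m kgt]; first by rewrite binom_odd0 ltr01.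
  by apply: binom_odd_lt1 => //; move: kgt; rewrite -natr1 addrK.
have M_opp (z : 'F_p) : z \in residues p (Mk k) -> - z \in residues p (Mk k).
  case/residuesP=> x xM ->; rewrite -mulrNz (mem_residues p_prime N_lt) //.
    by move: xM; rewrite !in_Mk abszN oppr_eq0.
  by rewrite abszN; apply: bM.
have zero_LM v : (0 \in residues p (L v)) = (0 \in residues p (Mk k)).
  rewrite -[0 : 'F_p]/(0%:~R) !(mem_residues p_prime N_lt) //.
  by rewrite L0 in_Mk eqxx orbF.
have cardL v : #|residues p (L v)| = k.
  by rewrite (card_residues p_prime N_lt).
have cardM : #|residues p (Mk k)| = k.
  by rewrite (card_residues p_prime N_lt) // card_Mk.
have [le_ eq_] := ncol_compare k0 cardL cardM M_opp zero_LM sgn neq pw od1.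
rewrite -[P_Sigma S k]/(P_list (fun _ : V => Mk k)).
rewrite !(P_list_ncol endsE f_neq p_prime N_lt es_all) //; split=> // /eq_ eqn.
(* Zero conflict means that the sign maps all of the second list into the first; the equal sizes
   make this an equality. *)
have LE e : e \in es -> L (f e).1 = scale (sigma e) (L (f e).2).
  move=> ees; have /eqP := eqn _ (map_f (constraint_of f p) ees).
  rewrite /conflict subn_eq0 /= => h.
  have /eqP hE : [set z in residues p (L (f e).2) |
      (sigma e)%:~R * z \in residues p (L (f e).1)] == residues p (L (f e).2).
    rewrite finset.eqEcard cardL h andbT.
    by apply/fintype.subsetP => z; rewrite inE => /andP[].
  apply/esym/eqP; rewrite eqEfcard; apply/andP; split; last first.
    rewrite Lk card_imfset ?Lk //=; apply: (can_inj (sigma_mulK e)).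
  apply/fsubsetP => _ /scaleP[x xL ->].
  have : (x%:~R : 'F_p) \in residues p (L (f e).2).
    by rewrite (mem_residues p_prime N_lt) ?(bL _ _ xL).
  rewrite -hE inE => /andP[_]; rewrite -intrM (mem_residues p_prime N_lt) //.
  by rewrite abszM absz_sigma mul1n (bL _ _ xL).
move=> e u v; have [e' e'es [ee <-]] := es_all e; rewrite /joins => /eqP ends_e.
have := endsE e'; rewrite ee ends_e => /setP uv.
have := uv (f e').1; have := uv (f e').2; rewrite !inE !eqxx orbT /=.
have := f_neq e'.
move=> nq /orP[]/eqP e2 /orP[]/eqP e1; rewrite ?e1 ?e2 ?eqxx // in nq.
  by rewrite -e1 -e2 LE.
by rewrite -e1 -e2 LE // scale_sigmaK.
Qed.

(** * Symmetry of the lists on unbalanced components *)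

Section UnbalancedComponents.
Variable L : V -> {fset int}.
Hypothesis L_edge : forall e (u v : V), joins e u v -> L v = scale (sigma e) (L u).

(** Each step of a walk from [x] through [t] to [z] scales the list by the sign of its edge. With
    [z = x] the zipped pairs are those of [is_cycle]. *)
Lemma scale_walk (es : seq E) (t : seq V) (x z : V) :
  [seq ends e | e <- es] =
    [seq [set q.1; q.2]%SET | q <- zip (x :: t) (rcons t z)] ->
  L z = scale (\prod_(e <- es) sigma e) (L x).
Proof.
elim: t x es => [|a t IH] x [|e es] //= [].
  move=> ee; case: es => // _; rewrite big_seq1.
  by apply: L_edge; rewrite /joins ee.
move=> ee /IH ->; rewrite big_cons mulrC -scaleM.
by rewrite -(@L_edge e x a) // /joins ee.
Qed.

Lemma prod_sigma (es : seq E) :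
  \prod_(e <- es) sigma e = (-1) ^+ count (fun e => sigma e == -1) es.
Proof.
elim: es => [|e es IH]; first by rewrite big_nil expr0.
rewrite big_cons IH /=; case: (sigma_sign e) => -> /=; first by rewrite mul1r.
by rewrite exprS.
Qed.

(** One turn around the cycle scales the list at its first vertex by the product of the signs, which
    is -1. *)
Lemma unbalanced_cycle_symmetric (vs : seq V) (es : seq E) :
  unbalanced_cycle vs es -> exists2 v, v \in vs & L v = scale (-1) (L v).
Proof.
case: vs => [|x t]; rewrite /unbalanced_cycle /is_cycle //=.
rewrite rot1_cons => /andP[/and3P[_ _ /eqP cyc] odd_es].
exists x; first exact: mem_head.
by rewrite {1}(scale_walk cyc) prod_sigma -signr_odd odd_es expr1.
Qed.

Lemma adj_symmetric (u v : V) : adj u v ->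
  L u = scale (-1) (L u) -> L v = scale (-1) (L v).
Proof.
case/existsP=> e /L_edge -> h; rewrite {1}h !scaleM; congr scale.
by rewrite mulrC.
Qed.

Lemma connect_symmetric (u v : V) : connect (@adj S) u v ->
  L u = scale (-1) (L u) -> L v = scale (-1) (L v).
Proof.
case/connectP=> s + ->; elim: s u => //= a s IH u /andP[ua sp] h.
by apply: IH sp _; apply: adj_symmetric ua h.
Qed.

Lemma adj_sym : symmetric (@adj S).
Proof.
by move=> u v; apply: eq_existsb => e; rewrite /joins finset.setUC.
Qed.

Lemma unbalanced_component_symmetric (C : {set V}) : unbalanced_component C ->
  forall v, v \in C -> L v = scale (-1) (L v).
Proof.
case=> -[w ->] [vs [es [/unbalanced_cycle_symmetric[x xvs Lx] sub]]] v.
have := sub x xvs; rewrite !inE => wx wv; apply: connect_symmetric Lx.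
by apply: connect_trans wv; rewrite (sym_connect_sym adj_sym).
Qed.

End UnbalancedComponents.

End SignedGraphTheory.

Theorem theorem1p2 (R : realType) (S : signed_graph) (k : nat)
    (k_gt0 : (0 < k)%N)
    (k_gt : (k%:R : R) > (#|edge S|%:R - 1) / ln (1 + Num.sqrt 2)) :
  [/\ ~~ odd k -> P_l0 S k = P_Sigma S k,
      odd k -> P_l1 S k = P_Sigma S k
    & forall L : vertex S -> {fset int},
        k_assignment k L ->
        (if odd k then zero_included L else zero_free L) ->
        P_list L = P_Sigma S k ->
        (forall (e : edge S) (u v : vertex S),
           joins e u v -> L v = scale (sigma e) (L u)) /\
        (unbalanced S ->
         forall C : {set vertex S}, unbalanced_component C ->
         forall v : vertex S, v \in C -> L v = scale (-1) (L v))].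
Proof.
have MkE : P_list (fun _ : vertex S => Mk k) = P_Sigma S k by [].
have cardM : k_assignment k (fun _ : vertex S => Mk k) by move=> v; apply: card_Mk.
split=> [ek|ok|L Lk L0 PL].
(* Some assignment exists, so the minimum is attained and is not the default value of [min_nat]. The
   constant assignment [Mk k] gives one inequality, the comparison applied to a minimiser the
   other. *)
- have /min_natP[[L [Lk L0 PL]] min_l] : exists n, exists L : vertex S -> {fset int},
      [/\ k_assignment k L, zero_free L & P_list L = n].
    have [L [Lk L0]] := zero_free_assignment_ex S k.
    by exists (P_list L), L.
  apply/eqP; rewrite eqn_leq; apply/andP; split.
    apply: min_l; exists (fun=> Mk k); split=> // v.
    by rewrite in_Mk eqxx (negPf ek) andbF.
  rewrite /P_l0 -PL; apply: (list_coloring_compare k_gt0 k_gt Lk _).1 => v.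
  by rewrite (negPf (L0 v)) (negPf ek).
- have /min_natP[[L [Lk L0 PL]] min_l] : exists n, exists L : vertex S -> {fset int},
      [/\ k_assignment k L, zero_included L & P_list L = n].
    have [L [Lk L0]] := zero_included_assignment_ex S k_gt0.
    by exists (P_list L), L.
  apply/eqP; rewrite eqn_leq; apply/andP; split.
    by apply: min_l; exists (fun=> Mk k); split=> // v; rewrite in_Mk ok.
  rewrite /P_l1 -PL; apply: (list_coloring_compare k_gt0 k_gt Lk _).1 => v.
  by rewrite (L0 v) ok.
have L0' v : (0 \in L v) = odd k.
  by move: L0; case: (odd k) => /(_ v) // /negPf.
have edgeL := (list_coloring_compare k_gt0 k_gt Lk L0').2 PL.
by split=> // _ C; apply: unbalanced_component_symmetric.
Qed.
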